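(* Let $\mathcal{G}$ be a graph equipped with an adapted complex structure $J$. If $v,w$ are vertices of $\mathcal{G}$ with $w=Jv$ then $\deg(v)$ and $\deg(w)$ have the same parity.
   Context: Graphs are finite and simple. For a graph $\mathcal{G}=(V,E)$ label $V=\{v_1,\dots,v_n\}$ and write $e_{i,j}$ ($i<j$) for the edge joining $v_i$ and $v_j$, if it exists. The Lie algebra $\mathfrak{n}_{\mathcal{G}}$ is the real vector space with basis $V\cup E$ and Lie bracket $[v_i,v_j]=e_{i,j}$ for $i<j$ if $v_i,v_j$ are adjacent, $[v_i,v_j]=0$ if they are not adjacent, and all elements of $E$ central. A complex structure on a real Lie algebra $\mathfrak{g}$ is a linear map $J:\mathfrak{g}\to\mathfrak{g}$ with $J^2=-\mathrm{Id}$ and $[x,y]+J([Jx,y]+[x,Jy])-[Jx,Jy]=0$ for all $x,y\in\mathfrak{g}$. An adapted complex structure on the graph $\mathcal{G}$ is a complex structure $J$ on $\mathfrak{n}_{\mathcal{G}}$ such that for every $x\in V\cup E$ either $Jx\in V\cup E$ or $-Jx\in V\cup E$. *)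

(* Defs.v *)
From HB Require Import structures.
From mathcomp Require Import all_boot all_order all_algebra.
From mathcomp Require Import ring.
From mathcomp Require Import reals.

Set Implicit Arguments.
Unset Strict Implicit.
Unset Printing Implicit Defensive.

Import GRing.Theory.
Local Open Scope ring_scope.

HB.mixin Record isLieAlgebra (R : pzRingType) g of GRing.Lmodule R g := {
  lie : g -> g -> g;
  lie_linearl : forall y, linear (lie^~ y);
  lie_linearr : forall x, linear (lie x);
  liexx : forall x, lie x x = 0;
  lie_jacobi : forall x y z,
    lie x (lie y z) + lie y (lie z x) + lie z (lie x y) = 0
}.

#[short(type="lieAlgType")]
HB.structure Definition LieAlgebra (R : pzRingType) :=
  { g of isLieAlgebra R g & GRing.Lmodule R g }.

Definition complex_structure (R : realType) (g : lieAlgType R)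
    (J : {linear g -> g}) : Prop :=
  (forall x, J (J x) = - x) /\
  (forall x y, lie x y + J (lie (J x) y + lie x (J y)) - lie (J x) (J y) = 0).

(* The vertex set is 'I_n, so that a graph comes with the labelling of its
   vertices on which the signs in the bracket below depend. *)
Record sgraph (n : nat) := SGraph {
  adj :> rel 'I_n;
  adj_sym : symmetric adj;
  adj_irr : irreflexive adj
}.

Section GraphLieAlgebra.
Variables (n : nat) (G : sgraph n).

Definition deg (v : 'I_n) : nat := #|[set w | G v w]|.

Definition edge : finType :=
  {p : 'I_n * 'I_n | (p.1 < p.2)%N && G p.1 p.2}.

Definition vert_or_edge : finType := ('I_n + edge)%type.

(* The vector space with basis V ∪ E: a vector is its family of coordinates. *)
Definition graph_lie (R : realType) : Type := {ffun vert_or_edge -> R^o}.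

Variable R : realType.
Local Notation nG := (graph_lie R).

HB.instance Definition _ := GRing.Lmodule.on nG.

Definition basis_vec (b : vert_or_edge) : nG := [ffun c => (c == b)%:R].

Definition vtx (v : 'I_n) : nG := basis_vec (inl v).

Definition edg (p : edge) : nG := basis_vec (inr p).

(* The bilinear extension of the bracket on V ∪ E: its coordinate on e_{i,j},
   where i < j, is x_i y_j - x_j y_i. *)
Definition graph_bracket (x y : nG) : nG :=
  [ffun b : vert_or_edge => match b return R^o with
    | inl _ => 0
    | inr p => x (inl (val p).1) * y (inl (val p).2)
             - x (inl (val p).2) * y (inl (val p).1)
    end].

Fact graph_bracket_linearl y : linear (graph_bracket^~ y).
Proof.
move=> a u v; apply/ffunP=> -[i|p]; rewrite !ffunE /=; first by rewrite scaler0 addr0.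
rewrite /GRing.scale /=; ring.
Qed.

Fact graph_bracket_linearr x : linear (graph_bracket x).
Proof.
move=> a u v; apply/ffunP=> -[i|p]; rewrite !ffunE /=; first by rewrite scaler0 addr0.
rewrite /GRing.scale /=; ring.
Qed.

Fact graph_bracketxx x : graph_bracket x x = 0.
Proof.
apply/ffunP=> -[i|p]; rewrite !ffunE //=; ring.
Qed.

Fact graph_bracket_jacobi x y z :
  graph_bracket x (graph_bracket y z) + graph_bracket y (graph_bracket z x)
  + graph_bracket z (graph_bracket x y) = 0.
Proof.
by apply/ffunP=> -[i|p]; rewrite !ffunE /= ?mulr0 ?mul0r ?subr0 ?addr0.
Qed.

HB.instance Definition _ := isLieAlgebra.Build R nG
  graph_bracket_linearl graph_bracket_linearr graph_bracketxx
  graph_bracket_jacobi.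

Fact vtxE (v k : 'I_n) : vtx v (inl k) = (k == v)%:R.
Proof. by rewrite ffunE. Qed.

Fact lie_vtxE i j (p : edge) :
  lie (vtx i) (vtx j) (inr p) =
  ((val p).1 == i)%:R * ((val p).2 == j)%:R
  - ((val p).2 == i)%:R * ((val p).1 == j)%:R :> R.
Proof. by rewrite [LHS]ffunE !vtxE. Qed.

Fact basis_vec_expansion (x : nG) : x = \sum_b (x b : R) *: basis_vec b.
Proof.
apply/ffunP=> c; rewrite sum_ffunE (bigD1 c) //= big1 ?addr0 => [|b bc].
  by rewrite !ffunE eqxx /GRing.scale /= mulr1.
by rewrite !ffunE eq_sym (negPf bc) /GRing.scale /= mulr0.
Qed.

Fact lie_vtx_edge (p : edge) :
  lie (vtx (val p).1) (vtx (val p).2) = edg p.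
Proof.
apply/ffunP=> -[k|q]; first by rewrite !ffunE.
rewrite lie_vtxE ffunE.
have -> : (inr q == inr p :> vert_or_edge) = (q == p) by [].
have -> : (q == p) = ((val q).1 == (val p).1) && ((val q).2 == (val p).2).
  by rewrite -(inj_eq val_inj); case: (val q) (val p) => [? ?] [].
have -> : ((val q).2 == (val p).1)%:R * ((val q).1 == (val p).2)%:R = 0 :> R.
  rewrite -natrM mulnb; case: andP => // -[/eqP q2 /eqP q1].
  have /andP[lt_p _] := valP p; have /andP[lt_q _] := valP q.
  by move: lt_q; rewrite q1 q2 ltnNge ltnW.
by rewrite subr0 -natrM mulnb.
Qed.

Fact lie_vtx_nonadj i j : ~~ G i j -> lie (vtx i) (vtx j) = 0.
Proof.
move=> nij; apply/ffunP=> -[k|q]; first by rewrite !ffunE.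
rewrite lie_vtxE ffunE -!natrM !mulnb.
have /andP[_ Gq] := valP q.
case: andP => [[/eqP q1 /eqP q2]|_]; first by rewrite -q1 -q2 Gq in nij.
case: andP => [[/eqP q2 /eqP q1]|_]; last by rewrite subr0.
by rewrite -q1 -q2 adj_sym Gq in nij.
Qed.

Fact lie_edg_central p x : lie (edg p) x = 0.
Proof.
by apply/ffunP=> -[k|[[k l] kl]]; rewrite !ffunE //= !mul0r subr0.
Qed.

Definition adapted_complex_structure (J : {linear nG -> nG}) : Prop :=
  complex_structure J /\
  (forall b, (exists c, J (basis_vec b) = basis_vec c) \/
             (exists c, - J (basis_vec b) = basis_vec c)).

End GraphLieAlgebra.

Arguments vtx {n} G R v.

(* Main.v *)
Require Import Defs.
From HB Require Import structures.
From mathcomp Require Import all_boot all_order all_algebra.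
From mathcomp Require Import reals.

(** Write [w = J v].  For a vertex [x] with [J x] an edge up to sign,
    integrability of [J] at [(v, x)] reads [[v,x] + J [w,x] = 0], so [x] is
    adjacent to both or to none of [v], [w].  If [J x = s y] with [y] a vertex
    and [s] a sign, it reads [[v,x] - s [w,y] = - J ([w,x] + s [v,y])]; since
    [J] preserves the number of nonzero coordinates, counting those on both
    sides shows that [x] lies in the symmetric difference of the neighbourhoods
    of [v] and [w] iff [y] does.  So [J] induces a fixed-point-free involution
    of this symmetric difference, whose cardinality is therefore even. *)

Set Implicit Arguments.
Unset Strict Implicit.
Unset Printing Implicit Defensive.

Import Order.TTheory GRing.Theory Num.Theory.

Local Open Scope ring_scope.

Lemma even_card_involution (T : finType) (f : T -> T) (A : {set T}) :
    {in A, forall x, f x \in A} -> {in A, forall x, f (f x) = x} ->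
    {in A, forall x, f x != x} ->
  ~~ odd #|A|.
Proof.
move=> fA fK fN.
(* [B] picks from each orbit of [f] in [A] the point of smaller rank, so [A] splits into [B] and its
   image, which have equal size. *)
pose B := [set x in A | (enum_rank x < enum_rank (f x))%N].
have BA x : x \in B -> x \in A by rewrite inE => /andP[].
have fB : f @: B = A :\: B.
  apply/setP=> y; rewrite in_setD; apply/imsetP/andP => [[x xB ->{y}]|[yB yA]].
    have xA := BA x xB; rewrite inE fA // fK //=.
    by move: xB; rewrite inE -leqNgt => /andP[_ /ltnW].
  exists (f y); last by rewrite fK.
  move: yB; rewrite !inE fA // yA fK //= -leqNgt leq_eqVlt => /orP[|//].
  by move/eqP/val_inj/enum_rank_inj/eqP; rewrite (negPf (fN y yA)).
have cfB : #|f @: B| = #|B|.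
  by apply: card_in_imset => x y /BA xA /BA yA fxy; rewrite -(fK x) // fxy fK.
have sBA : B \subset A by apply/subsetP=> x /BA.
rewrite -(cardsID B A) -fB cfB; move/setIidPr: sBA => ->.
by rewrite addnn odd_double.
Qed.

Lemma odd_card_setD_sym (T : finType) (A B : {set T}) :
  odd #|(A :\: B) :|: (B :\: A)| = odd #|A| (+) odd #|B|.
Proof.
rewrite cardsU.
have -> : (A :\: B) :&: (B :\: A) = set0.
  by apply/setP=> x; rewrite !inE; case: (x \in A); case: (x \in B).
rewrite cards0 subn0 -(cardsID B A) -(cardsID A B) setIC !oddD.
by case: (odd #|B :&: A|); case: (odd #|A :\: B|); case: (odd #|B :\: A|).
Qed.

Section Support.
Variables (R : realType) (n : nat) (G : sgraph n).
Local Notation nG := (graph_lie G R).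

Definition supp (x : nG) : {set vert_or_edge G} := [set b | x b != 0].

Lemma suppN x : supp (- x) = supp x.
Proof. by apply/setP=> b; rewrite !inE !ffunE oppr_eq0. Qed.

Lemma suppZ (s : R) x : s != 0 -> supp (s *: x) = supp x.
Proof.
by move=> s0; apply/setP=> b; rewrite !inE !ffunE /GRing.scale /= mulf_eq0 (negPf s0).
Qed.

Lemma suppD x y : [disjoint supp x & supp y] -> supp (x + y) = supp x :|: supp y.
Proof.
move=> dxy; apply/setP=> b; rewrite !inE !ffunE.
have := disjointFr dxy (x := b); rewrite !inE.
have [->|x0 /(_ isT)/negbFE/eqP->] := eqVneq (x b) 0; first by rewrite add0r.
by rewrite addr0 x0.
Qed.

Lemma card_suppD x y :
  [disjoint supp x & supp y] -> #|supp (x + y)| = (#|supp x| + #|supp y|)%N.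
Proof.
by move=> dxy; rewrite suppD // cardsU disjoint_setI0 // cards0 subn0.
Qed.

Lemma lie_vtxC i j : lie (vtx G R i) (vtx G R j) = - lie (vtx G R j) (vtx G R i).
Proof.
by apply/ffunP=> -[k|p]; rewrite !ffunE ?oppr0 // opprB mulrC [X in _ - X]mulrC.
Qed.

Lemma supp_lie_vtx i j (p : edge G) :
  (inr p \in supp (lie (vtx G R i) (vtx G R j))) =
  (val p == (i, j)) || (val p == (j, i)).
Proof.
rewrite inE lie_vtxE -!natrM !mulnb.
case: p => -[k l] /= /andP[lt_kl _]; rewrite !xpair_eqE [(l == i) && _]andbC.
have [/andP[/eqP ki /eqP lj]|_] := boolP ((k == i) && (l == j)); last first.
  by case: (_ && _); rewrite ?subrr ?eqxx // sub0r oppr_eq0 oner_eq0.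
case: andP => [[/eqP kj _]|_]; last by rewrite subr0 oner_eq0.
by move: lt_kl; rewrite kj lj ltnn.
Qed.

(** The bracket of two vertices is zero or a basis vector up to sign, so counting supports turns
    bracket identities into adjacency identities, with all signs forgotten. *)
Lemma card_supp_lie_vtx i j : #|supp (lie (vtx G R i) (vtx G R j))| = G i j.
Proof.
wlog le_ij : i j / (i <= j)%N => [wl|].
  have [/wl//|/ltnW/wl] := leqP i j.
  by rewrite lie_vtxC suppN adj_sym.
have [Gij|nGij] := boolP (G i j); last first.
  rewrite lie_vtx_nonadj //; apply/eqP; rewrite cards_eq0; apply/eqP/setP=> b.
  by rewrite !inE ffunE eqxx.
have lt_ij : (i < j)%N.
  rewrite ltn_neqAle le_ij andbT; apply: contraL Gij => /eqP/val_inj ->.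
  by rewrite adj_irr.
have ijE : (i < j)%N && G i j by rewrite lt_ij.
have := lie_vtx_edge R (exist _ (i, j) ijE : edge G); rewrite /= => ->.
rewrite -(cards1 (inr (exist _ (i, j) ijE) : vert_or_edge G)).
congr #|pred_of_set _|; apply/setP=> b.
by rewrite !inE ffunE; have [_|_] := eqVneq b _; rewrite ?oner_eq0 ?eqxx.
Qed.

(** The two hypotheses say that the unordered pairs differ, so the brackets cannot meet in a common
    edge. *)
Lemma disjoint_supp_lie_vtx i j k l :
    (i, j) != (k, l) -> (i, j) != (l, k) ->
  [disjoint supp (lie (vtx G R i) (vtx G R j))
          & supp (lie (vtx G R k) (vtx G R l))].
Proof.
move=> n1 n2; apply/pred0P=> -[m|p] /=; first by rewrite !inE ffunE eqxx.
rewrite !supp_lie_vtx; apply/negP=> /andP[/orP[] /eqP-> ].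
  by rewrite (negPf n1) (negPf n2).
have swap (a b : 'I_n * 'I_n) : ((a.2, a.1) == (b.2, b.1)) = (a == b).
  by case: a b => [? ?] [? ?]; rewrite !xpair_eqE andbC.
by rewrite (swap (i, j) (l, k)) (swap (i, j) (k, l)) (negPf n1) (negPf n2).
Qed.

End Support.

Section AdaptedStructure.
Variables (R : realType) (n : nat) (G : sgraph n).
Local Notation nG := (graph_lie G R).
Variable J : {linear nG -> nG}.
Hypothesis hJ : adapted_complex_structure J.

Lemma scale_basis_vec_inj (s t : R) (b c : vert_or_edge G) :
  s != 0 -> s *: basis_vec R b = t *: basis_vec R c -> b = c /\ s = t.
Proof.
move=> s0 /ffunP/(_ b); rewrite !ffunE eqxx /GRing.scale /= mulr1.
by case: eqP => [-> ->|_]; rewrite ?mulr1 // mulr0 => s0'; rewrite s0' eqxx in s0.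
Qed.

Lemma adapted_signed_perm :
  exists (f : vert_or_edge G -> vert_or_edge G) (s : vert_or_edge G -> R),
  [/\ forall b, J (basis_vec R b) = s b *: basis_vec R (f b),
      forall b, s b != 0, involutive f & forall b, f b != b].
Proof.
have [[JJ _] Jb] := hJ.
have /fin_all_exists[f /fin_all_exists[s fs]] : forall b, exists c (s : R),
    J (basis_vec R b) = s *: basis_vec R c /\ s != 0.
  move=> b; have [[c Jc]|[c Jc]] := Jb b; exists c.
    by exists 1; rewrite scale1r oner_eq0.
  by exists (-1); rewrite scaleN1r -Jc opprK oppr_eq0 oner_eq0.
(* Compare both sides of [J (J b) = - b], each being a multiple of a single basis vector. *)
have ffs b : f (f b) = b /\ s b * s (f b) = -1.
  have [Jf s0] := fs b; have [Jff s0'] := fs (f b).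
  apply: scale_basis_vec_inj; first by rewrite mulf_neq0.
  by rewrite scaleN1r -JJ Jf linearZ_LR Jff scalerA.
exists f, s; split=> [b|b|b|b]; try by case: (fs b).
  by case: (ffs b).
(* A fixed point [b] would give [s b * s b = -1], impossible in a real field. *)
apply/eqP=> fb; have [_] := ffs b; rewrite fb => ss.
by have := sqr_ge0 (s b); rewrite expr2 ss oppr_ge0 ler10.
Qed.

(** The coordinate of [x] at [b] moves to [f b] with a nonzero factor, so the support of [J x] is
    the image of that of [x] under the bijection [f]. *)
Lemma card_supp_adapted x : #|supp (J x)| = #|supp x|.
Proof.
have [f [s [Jf s0 fK _]]] := adapted_signed_perm.
have Jx b : J x (f b) = s b * x b.
  rewrite {1}[x]basis_vec_expansion linear_sum /= sum_ffunE (bigD1 b) //= big1.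
    by rewrite addr0 linearZ_LR Jf !ffunE eqxx /GRing.scale /= mulr1 mulrC.
  move=> c cb; rewrite linearZ_LR Jf !ffunE (inj_eq (inv_inj fK)) eq_sym.
  by rewrite (negPf cb) /GRing.scale /= !mulr0.
rewrite -(card_imset (mem (supp x)) (inv_inj fK)).
congr #|pred_of_set _|; apply/setP=> b.
rewrite -[b]fK (mem_imset _ _ (inv_inj fK)) !inE Jx mulf_eq0.
by rewrite (negPf (s0 _)).
Qed.

Section Pair.
Variables v w : 'I_n.
Hypothesis Jv : vtx G R w = J (vtx G R v).

Lemma adj_eq_of_edge x p (s : R) :
  J (vtx G R x) = s *: edg R p -> G v x = G w x.
Proof.
move=> Jx; have [[_ /(_ (vtx G R v) (vtx G R x))]] := hJ.
rewrite -Jv Jx.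
have lie0 u : lie u (s *: edg R p) = 0 :> nG.
  by apply/ffunP=> -[k|p']; rewrite !ffunE /= /GRing.scale /= ?mulr0 ?subrr.
rewrite !lie0 addr0 subr0 => /eqP; rewrite addr_eq0 => /eqP E _.
have := congr1 (fun z : nG => #|supp z|) E.
rewrite suppN card_supp_adapted // !card_supp_lie_vtx.
by case: (G v x); case: (G w x).
Qed.

(** The three inequalities make {v,x} differ from {w,y}, and {w,x} from {v,y}. Nothing cancels on
    either side, and the support sizes add. *)
Lemma adj_balance x y (s : R) :
    s != 0 -> J (vtx G R x) = s *: vtx G R y -> v != w -> x != v -> x != w ->
  (G v x + G w y = G w x + G v y)%N.
Proof.
move=> s0 Jx vw xv xw; have [[_ /(_ (vtx G R v) (vtx G R x))]] := hJ.
rewrite -Jv Jx.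
have lieZ u : lie u (s *: vtx G R y) = s *: lie u (vtx G R y) :> nG.
  apply/ffunP=> -[k|p]; rewrite !ffunE /GRing.scale /= ?mulr0 //.
  by rewrite mulrBr !(mulrCA s).
rewrite !lieZ addrAC => /eqP; rewrite addr_eq0 => /eqP E _.
have := congr1 (fun z : nG => #|supp z|) E.
rewrite suppN card_supp_adapted !card_suppD ?suppN ?suppZ //.
- by rewrite !card_supp_lie_vtx.
- by apply: disjoint_supp_lie_vtx; rewrite xpair_eqE negb_and ?xv ?(eq_sym w) ?vw ?orbT.
- by apply: disjoint_supp_lie_vtx; rewrite xpair_eqE negb_and ?xw ?vw ?orbT.
Qed.

End Pair.

End AdaptedStructure.

Theorem corollary4p8 (R : realType) (n : nat) (G : sgraph n)
    (J : {linear graph_lie G R -> graph_lie G R})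
    (hJ : adapted_complex_structure J) (v w : 'I_n)
    (hvw : vtx G R w = J (vtx G R v)) :
  odd (deg G v) = odd (deg G w).
Proof.
have [f [s [Jf s0 fK fN]]] := adapted_signed_perm hJ.
have fv : f (inl v) = inl w.
  have := Jf (inl v); rewrite -[J _]hvw -[vtx G R w]scale1r.
  by case/scale_basis_vec_inj; rewrite ?oner_eq0.
have fw : f (inl w) = inl v by rewrite -fv fK.
have vw : v != w by have := fN (inl v); rewrite fv eq_sym.
apply/eqP; rewrite -negb_add -odd_card_setD_sym.
set S := _ :|: _.
have SE x : (x \in S) = (G v x != G w x).
  by rewrite !inE; case: (G v x); case: (G w x).
(* The default [x], used when [J] sends [x] to an edge, never occurs on [S]: such an [x] is adjacent
   to both or neither of [v] and [w]. *)
pose g x := if f (inl x) is inl y then y else x.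
have fg : {in S, forall x, f (inl x) = inl (g x)}.
  move=> x; rewrite SE /g; case fx: (f (inl x)) => [//|p] /eqP[].
  by apply: (adj_eq_of_edge hJ hvw (p := p) (s := s (inl x))); rewrite Jf fx.
apply: (even_card_involution (f := g)) => x xS; have fx := fg x xS.
(* The balance does not cover [v] and [w]. These are swapped by [g], and each lies in [S] exactly
   when they are adjacent. *)
- have [xv|xv] := eqVneq x v.
    move: fx xS; rewrite xv fv => -[<-].
    by rewrite !SE !adj_irr (adj_sym G w v) eq_sym.
  have [xw|xw] := eqVneq x w.
    move: fx xS; rewrite xw fw => -[<-].
    by rewrite !SE !adj_irr (adj_sym G w v) eq_sym.
  have Jx : J (vtx G R x) = s (inl x) *: vtx G R (g x) by rewrite Jf fx.
  (* Rearranged, the balance says that the difference of the adjacencies to [v] and [w] is the same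
     for [x] and [g x]; membership in [S] means that it is nonzero. *)
  have := adj_balance hJ hvw (s0 _) Jx vw xv xw.
  move: xS; rewrite !SE.
  by do 4!case: (G _ _).
- by rewrite /g -/(g x) -fx fK.
- by have := fN (inl x); rewrite fx.
Qed.
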